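(* Let $\alpha<\beta$ be infinite ordinals and let $\mathbf L=\{\mathfrak A\in\mathbf{PA}_\beta:\mathfrak A=\mathfrak{Sg}^{\mathfrak A}\mathfrak{Nr}_\alpha\mathfrak A\}$. Let $\mathfrak{Nr}:\mathbf L\to\mathbf{PA}_\alpha$ be the neat reduct functor $\mathfrak A\mapsto\mathfrak{Nr}_\alpha\mathfrak A$ (morphisms being injective homomorphisms, and $\mathfrak{Nr}$ acting on them by restriction). Then $\mathfrak{Nr}$ is invertible: there are a functor $G:\mathbf{PA}_\alpha\to\mathbf L$ and natural isomorphisms $\mu:1_{\mathbf L}\to G\circ\mathfrak{Nr}$ and $\epsilon:\mathfrak{Nr}\circ G\to1_{\mathbf{PA}_\alpha}$.
   Context: For an infinite ordinal $\alpha$, $\mathbf{PA}_\alpha$ is the variety of (Halmos) polyadic algebras of dimension $\alpha$ (without equality): algebras $(A,+,\cdot,-,0,1,\mathsf c_{(\Gamma)},\mathsf s_\tau)_{\Gamma\subseteq\alpha,\ \tau\in{}^\alpha\alpha}$ with Boolean reduct such that: $\mathsf c_{(\Gamma)}0=0$; $x\le\mathsf c_{(\Gamma)}x$; $\mathsf c_{(\Gamma)}(x\cdot\mathsf c_{(\Gamma)}y)=\mathsf c_{(\Gamma)}x\cdot\mathsf c_{(\Gamma)}y$; $\mathsf c_{(\emptyset)}x=x$; $\mathsf c_{(\Gamma)}\mathsf c_{(\Delta)}x=\mathsf c_{(\Gamma\cup\Delta)}x$; each $\mathsf s_\tau$ is a Boolean endomorphism; $\mathsf s_{Id}x=x$;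 $\mathsf s_{\sigma\circ\tau}x=\mathsf s_\sigma\mathsf s_\tau x$; if $\sigma\upharpoonright(\alpha\setminus\Gamma)=\tau\upharpoonright(\alpha\setminus\Gamma)$ then $\mathsf s_\sigma\mathsf c_{(\Gamma)}x=\mathsf s_\tau\mathsf c_{(\Gamma)}x$; if $\tau^{-1}(\Gamma)=\Delta$ and $\tau\upharpoonright\Delta$ is one-to-one then $\mathsf c_{(\Gamma)}\mathsf s_\tau x=\mathsf s_\tau\mathsf c_{(\Delta)}x$. For $\alpha<\beta$ and $\mathfrak B\in\mathbf{PA}_\beta$, $\mathfrak{Nr}_\alpha\mathfrak B\in\mathbf{PA}_\alpha$ has universe $\{x\in B:\mathsf c_{(\beta\setminus\alpha)}x=x\}$, the Boolean operations and $\mathsf c_{(\Gamma)}$ ($\Gamma\subseteq\alpha$) of $\mathfrak B$, and $\mathsf s_\tau:=\mathsf s^{\mathfrak B}_{\tau\cup Id_{\beta\setminus\alpha}}$ for $\tau\in{}^\alpha\alpha$. $\mathfrak{Sg}^{\mathfrak A}X$ is the subalgebra generated by $X$. *)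

(* Defs.v *)
From HB Require Import structures.
From mathcomp Require Import all_boot all_order.
From mathcomp Require Import boolp classical_sets functions cardinality wochoice.

Set Implicit Arguments.
Unset Strict Implicit.
Unset Printing Implicit Defensive.

Import Order.Theory.

Local Open Scope classical_set_scope.
Local Open Scope order_scope.

(* The Boolean reduct of a polyadic algebra is a [ctbDistrLatticeType]
   ([+], [.], [-], 0, 1 are [`|`], [`&`], [~`], [\bot], [\top]); the
   one-element algebra, where [\bot = \top], is not excluded. *)

Fact polyadic_display : Order.disp_t. Proof. exact: Order.Disp tt tt. Qed.

Definition boolean_morphism d (A : ctbDistrLatticeType d)
    d' (B : ctbDistrLatticeType d') (f : A -> B) : Prop :=
  [/\ {morph f : x y / x `|` y}, {morph f : x y / x `&` y},
      {morph f : x / ~` x}, f \bot = \bot & f \top = \top].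

HB.mixin Record hasPolyadic (I : Type) A
    of Order.CTBDistrLattice polyadic_display A := {
  cyl : set I -> A -> A;
  subst : (I -> I) -> A -> A;
  cyl_bot : forall G, cyl G \bot = \bot;
  cyl_le : forall G x, x <= cyl G x;
  cyl_meet : forall G x y, cyl G (x `&` cyl G y) = cyl G x `&` cyl G y;
  cyl_set0 : forall x, cyl set0 x = x;
  cyl_setU : forall G D x, cyl G (cyl D x) = cyl (G `|` D)%classic x;
  subst_boolean : forall t, boolean_morphism (subst t);
  subst_id : forall x, subst id x = x;
  subst_comp : forall s t x, subst (s \o t) x = subst s (subst t x);
  subst_cyl : forall (s t : I -> I) G x,
    (forall i, (~` G)%classic i -> s i = t i) ->
    subst s (cyl G x) = subst t (cyl G x);
  cyl_subst : forall (t : I -> I) G D x,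
    t @^-1` G = D -> set_inj D t ->
    cyl G (subst t x) = subst t (cyl D x)
}.

HB.structure Definition Polyadic (I : Type) :=
  {A of hasPolyadic I A & Order.CTBDistrLattice polyadic_display A}.

Notation polyadicType := Polyadic.type.

Definition subuniverse (I : Type) (A : polyadicType I) (S : set A) : Prop :=
  [/\ S \bot /\ S \top,
      forall x, S x -> S (~` x),
      forall x y, S x -> S y -> S (x `&` y) /\ S (x `|` y),
      forall (G : set I) x, S x -> S (cyl G x) &
      forall (t : I -> I) x, S x -> S (subst t x)].

Definition generated (I : Type) (A : polyadicType I) (X : set A) : set A :=
  smallest (@subuniverse I A) X.

Record embedding (I : Type) (A B : polyadicType I) := Embedding {
  embedding_fun :> A -> B;
  embedding_inj : injective embedding_fun;
  embedding_boolean : boolean_morphism embedding_fun;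
  embedding_cyl :
    forall (G : set I) x, embedding_fun (cyl G x) = cyl G (embedding_fun x);
  embedding_subst :
    forall (t : I -> I) x, embedding_fun (subst t x) = subst t (embedding_fun x)
}.

Lemma embedding_ext (I : Type) (A B : polyadicType I) (f g : embedding A B) :
  f =1 g -> f = g.
Proof.
case: f g => [f f1 f2 f3 f4] [g g1 g2 g3 g4] /= /funext fg.
by move: f1 f2 f3 f4; rewrite fg => *; congr Embedding; exact: Prop_irrelevance.
Qed.

Section EmbeddingOps.
Variable I : Type.
Implicit Types A B C : polyadicType I.

Lemma idemb_boolean A : boolean_morphism (@id A).
Proof. by []. Qed.

Definition idemb A : embedding A A :=
  Embedding (@inj_id A) (@idemb_boolean A) (fun _ _ => erefl) (fun _ _ => erefl).

Variables (A B C : polyadicType I) (g : embedding B C) (f : embedding A B).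

Lemma compemb_boolean : boolean_morphism (g \o f).
Proof.
have [gU gI gC g0 g1] := embedding_boolean g.
have [fU fI fC f0 f1] := embedding_boolean f.
split=> [x y|x y|x||] /=; rewrite ?fU ?fI ?fC ?f0 ?f1 //.
Qed.

Lemma compemb_cyl (G : set I) x : (g \o f) (cyl G x) = cyl G ((g \o f) x).
Proof. by rewrite /= !embedding_cyl. Qed.

Lemma compemb_subst (t : I -> I) x : (g \o f) (subst t x) = subst t ((g \o f) x).
Proof. by rewrite /= !embedding_subst. Qed.

Definition compemb : embedding A C :=
  Embedding (inj_comp (@embedding_inj _ _ _ g) (@embedding_inj _ _ _ f))
    compemb_boolean compemb_cyl compemb_subst.

End EmbeddingOps.

Record category := Category {
  obj :> Type;
  hom : obj -> obj -> Type;
  idm : forall a, hom a a;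
  compm : forall a b c, hom b c -> hom a b -> hom a c;
  compm1 : forall a b (f : hom a b), compm f (idm a) = f;
  comp1m : forall a b (f : hom a b), compm (idm b) f = f;
  compmA : forall a b c d (h : hom c d) (g : hom b c) (f : hom a b),
    compm h (compm g f) = compm (compm h g) f
}.

Definition full_subcategory (C : category) (P : C -> Prop) : category :=
  @Category {a : C | P a} (fun a b => hom (sval a) (sval b))
    (fun a => idm (sval a)) (fun _ _ _ g f => compm g f)
    (fun _ _ f => compm1 f) (fun _ _ f => comp1m f)
    (fun _ _ _ _ h g f => compmA h g f).

Record functor (C D : category) := Functor {
  fobj :> C -> D;
  fmap : forall a b, hom a b -> hom (fobj a) (fobj b);
  fmap1 : forall a, fmap (idm a) = idm (fobj a);
  fmapM : forall a b c (g : hom b c) (f : hom a b),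
    fmap (compm g f) = compm (fmap g) (fmap f)
}.

Definition functor_id (C : category) : functor C C :=
  @Functor C C id (fun _ _ f => f) (fun _ => erefl) (fun _ _ _ _ _ => erefl).

Section FunctorComp.
Variables (C D E : category) (G : functor D E) (F : functor C D).

Lemma fcomp1 (a : C) : fmap G (fmap F (idm a)) = idm (G (F a)).
Proof. by rewrite !fmap1. Qed.

Lemma fcompM (a b c : C) (g : hom b c) (f : hom a b) :
  fmap G (fmap F (compm g f)) = compm (fmap G (fmap F g)) (fmap G (fmap F f)).
Proof. by rewrite !fmapM. Qed.

Definition functor_comp : functor C E :=
  @Functor C E (fun a => G (F a)) (fun _ _ f => fmap G (fmap F f)) fcomp1 fcompM.

End FunctorComp.

Definition isomorphism (C : category) (a b : C) (f : hom a b) : Prop :=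
  exists g : hom b a, compm g f = idm a /\ compm f g = idm b.

Record natural_iso (C D : category) (F G : functor C D) := NaturalIso {
  component :> forall a, hom (F a) (G a);
  component_natural : forall a b (f : hom a b),
    compm (component b) (fmap F f) = compm (fmap G f) (component a);
  component_iso : forall a, isomorphism (component a)
}.

Section PAcat.
Variable I : Type.

Lemma compemb1 (A B : polyadicType I) (f : embedding A B) :
  compemb f (idemb A) = f.
Proof. exact: embedding_ext. Qed.

Lemma comp1emb (A B : polyadicType I) (f : embedding A B) :
  compemb (idemb B) f = f.
Proof. exact: embedding_ext. Qed.

Lemma compembA (A B C D : polyadicType I)
    (h : embedding C D) (g : embedding B C) (f : embedding A B) :
  compemb h (compemb g f) = compemb (compemb h g) f.
Proof. exact: embedding_ext. Qed.

Definition PA : category := Category compemb1 comp1emb compembA.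

End PAcat.


Section CylTheory.
Variables (I : Type) (A : polyadicType I) (G : set I).
Implicit Types x y : A.

Lemma cyl_idem x : cyl G (cyl G x) = cyl G x.
Proof. by rewrite cyl_setU setUid. Qed.

Lemma cyl_fixed_meet x y :
  cyl G x = x -> cyl G y = y -> cyl G (x `&` y) = x `&` y.
Proof. by move=> xG yG; rewrite -yG cyl_meet xG. Qed.

Lemma cyl_fixed_compl x : cyl G x = x -> cyl G (~` x) = ~` x.
Proof.
move=> xG; apply/le_anti; rewrite cyl_le andbT -disj_leC.
by rewrite -{2}xG -cyl_meet xG meetC meetxC cyl_bot.
Qed.

Lemma cyl_fixed_join x y :
  cyl G x = x -> cyl G y = y -> cyl G (x `|` y) = x `|` y.
Proof.
move=> xG yG; rewrite -[x `|` y]complK complU.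
by apply/cyl_fixed_compl/cyl_fixed_meet; apply: cyl_fixed_compl.
Qed.

Lemma cyl_fixed_top : cyl G \top = \top :> A.
Proof. by apply/le_anti; rewrite lex1 cyl_le. Qed.

End CylTheory.

(* An ordinal [beta] is the type of its elements, so that an ordinal below it is
   an element [alpha : beta], identified with the initial segment
   [{i : beta | i < alpha}].  The definitions below do not use that [<] is a
   well-order; this has to be assumed separately. *)
Section Segment.
Variables (d : Order.disp_t) (beta : orderType d) (alpha : beta).

Definition segment : Type := {i : beta | i < alpha}.

Definition outside : set beta := [set i | ~~ (i < alpha)].

(* [t] extended by the identity on [beta \ alpha] *)
Definition extend (t : segment -> segment) (i : beta) : beta :=
  if insub i is Some j then val (t j) else i.

Lemma extend_val t (j : segment) : extend t (val j) = val (t j).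
Proof. by rewrite /extend valK. Qed.

Lemma extend_out t i : outside i -> extend t i = i.
Proof. by move=> /= oi; rewrite /extend insubN. Qed.

Lemma segmentP i : (exists j : segment, i = val j) \/ outside i.
Proof.
case: (boolP (i < alpha)) => h; [left|by right].
by exists (Sub i h); rewrite SubK.
Qed.

Lemma outside_val (j : segment) : ~ outside (val j).
Proof. by move/negP; apply; exact: (valP j). Qed.

Lemma extend_id : extend id = id.
Proof.
apply/funext => i; have [[j ->]|o] := segmentP i; first by rewrite extend_val.
by rewrite extend_out.
Qed.

Lemma extend_comp s t : extend (s \o t) = extend s \o extend t.
Proof.
apply/funext => i /=; have [[j ->]|o] := segmentP i.
  by rewrite !extend_val.
by rewrite !extend_out.
Qed.

Lemma image_valP (G : set segment) (j : segment) : (val @` G) (val j) <-> G j.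
Proof. by split=> [[k Gk /val_inj <-]|Gj]; last exists j. Qed.

Lemma image_val_out (G : set segment) i : outside i -> ~ (val @` G) i.
Proof. by move=> o [j _ ji]; move: o; rewrite -ji => /outside_val. Qed.

Lemma extend_eq_off (s t : segment -> segment) (G : set segment) :
  (forall j, (~` G)%classic j -> s j = t j) ->
  forall i, (~` (val @` G))%classic i -> extend s i = extend t i.
Proof.
move=> st i; have [[j ->] nG|o _] := segmentP i; last by rewrite !extend_out.
by rewrite !extend_val st // => Gj; apply: nG; apply/image_valP.
Qed.

Lemma extend_preimage (t : segment -> segment) (G D : set segment) :
  t @^-1` G = D -> extend t @^-1` (val @` G) = val @` D.
Proof.
move=> <-; apply/seteqP; split=> i /=; have [[j ->]|o] := segmentP i.
- by rewrite extend_val => /image_valP Gj; apply/image_valP.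
- by rewrite extend_out // => /(image_val_out o).
- by move/image_valP => Gj; rewrite extend_val; apply/image_valP.
- by move/(image_val_out o).
Qed.

Lemma extend_inj (t : segment -> segment) (D : set segment) :
  set_inj D t -> set_inj (val @` D) (extend t).
Proof.
move=> ti _ _ /set_mem[i Di <-] /set_mem[j Dj <-].
rewrite !extend_val => /val_inj /ti ->; rewrite ?mem_setE //; exact/mem_set.
Qed.

Lemma extend_preimage_outside t : extend t @^-1` outside = outside.
Proof.
apply/seteqP; split=> i; rewrite /preimage /=;
  have [[j ->]|o] := segmentP i => //.
- by rewrite extend_val => /outside_val.
- by move/outside_val.
- by rewrite extend_out.
Qed.

Lemma extend_inj_outside t : set_inj outside (extend t).
Proof. by move=> i j /set_mem oi /set_mem oj; rewrite !extend_out. Qed.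

End Segment.

Section NeatReduct.
Variables (d : Order.disp_t) (beta : orderType d) (alpha : beta).
Variable A : polyadicType beta.

Notation S := (segment alpha).

Definition neat : pred A := fun x => cyl (outside alpha) x == x.

Definition neat_reduct : Type := {x : A | neat x}.

HB.instance Definition _ := [isSub of neat_reduct for @sval A neat].
HB.instance Definition _ := [Choice of neat_reduct by <:].

Lemma neat_meet : {in neat &, forall x y, x `&` y \in neat}.
Proof. by move=> x y /eqP xk /eqP yk; exact/eqP/cyl_fixed_meet. Qed.

Lemma neat_join : {in neat &, forall x y, x `|` y \in neat}.
Proof. by move=> x y /eqP xk /eqP yk; exact/eqP/cyl_fixed_join. Qed.

Lemma neat_bot : \bot \in neat.
Proof. exact/eqP/cyl_bot. Qed.

Lemma neat_top : \top \in neat.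
Proof. exact/eqP/cyl_fixed_top. Qed.

Lemma neat_compl x : neat x -> neat (~` x).
Proof. by move=> /eqP xk; exact/eqP/cyl_fixed_compl. Qed.

Lemma neat_cyl (G : set S) x : neat x -> neat (cyl (val @` G) x).
Proof. by move=> /eqP xk; apply/eqP; rewrite cyl_setU setUC -cyl_setU xk. Qed.

Lemma neat_subst (t : S -> S) x : neat x -> neat (subst (extend t) x).
Proof.
move=> /eqP xk; apply/eqP.
have := cyl_subst _ _ _ x (extend_preimage_outside t) (@extend_inj_outside _ _ _ t).
by move=> ->; rewrite xk.
Qed.

HB.instance Definition _ := Order.SubChoice_isTBSubLattice.Build
  polyadic_display A neat polyadic_display neat_reduct
  neat_meet neat_join neat_bot neat_top.

Implicit Types x y z : neat_reduct.

Lemma val_neat_bot : val (\bot : neat_reduct) = \bot.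
Proof. exact: Order.val0_subproof. Qed.

Lemma val_neat_top : val (\top : neat_reduct) = \top.
Proof. exact: Order.val1_subproof. Qed.

Lemma val_neat_meet x y : val (x `&` y) = val x `&` val y.
Proof. exact: Order.valI_subproof. Qed.

Lemma val_neat_join x y : val (x `|` y) = val x `|` val y.
Proof. exact: Order.valU_subproof. Qed.

Lemma neat_meetUl : @left_distributive neat_reduct _ Order.meet Order.join.
Proof. by move=> x y z; apply: val_inj; rewrite !(val_neat_meet, val_neat_join) meetUl. Qed.

HB.instance Definition _ := Order.Lattice_Meet_isDistrLattice.Build
  polyadic_display neat_reduct neat_meetUl.

Definition neat_reduct_compl x : neat_reduct :=
  Sub (~` val x) (neat_compl (valP x)).

Lemma neat_joinxC x : x `|` neat_reduct_compl x = \top.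
Proof. by apply: val_inj; rewrite val_neat_join val_neat_top joinxC. Qed.

Lemma neat_meetxC x : x `&` neat_reduct_compl x = \bot.
Proof. by apply: val_inj; rewrite val_neat_meet val_neat_bot meetxC. Qed.

HB.instance Definition _ := Order.TBDistrLattice_hasComplement.Build
  polyadic_display neat_reduct neat_joinxC neat_meetxC.


Lemma val_neat_compl x : val (~` x) = ~` val x.
Proof. by []. Qed.

Definition neat_reduct_cyl (G : set S) x : neat_reduct :=
  Sub (cyl (val @` G) (val x)) (neat_cyl G (valP x)).

Definition neat_reduct_subst (t : S -> S) x : neat_reduct :=
  Sub (subst (extend t) (val x)) (neat_subst t (valP x)).

Let nc := neat_reduct_cyl.
Let ns := neat_reduct_subst.

Lemma val_nc G x : val (nc G x) = cyl (val @` G) (val x).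
Proof. by []. Qed.

Lemma val_ns t x : val (ns t x) = subst (extend t) (val x).
Proof. by []. Qed.

Lemma neat_cyl_bot G : nc G \bot = \bot.
Proof. by apply: val_inj; rewrite val_nc val_neat_bot cyl_bot. Qed.

Lemma neat_cyl_le G x : x <= nc G x.
Proof.
by apply/meet_idPl/val_inj; rewrite val_neat_meet val_nc; apply/meet_idPl/cyl_le.
Qed.

Lemma neat_cyl_meet G x y : nc G (x `&` nc G y) = nc G x `&` nc G y.
Proof. by apply: val_inj; rewrite !(val_neat_meet, val_nc) cyl_meet. Qed.

Lemma neat_cyl_set0 x : nc set0 x = x.
Proof. by apply: val_inj; rewrite val_nc image_set0 cyl_set0. Qed.

Lemma neat_cyl_setU G D x : nc G (nc D x) = nc (G `|` D)%classic x.
Proof. by apply: val_inj; rewrite !val_nc cyl_setU image_setU. Qed.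

Lemma neat_subst_boolean t : boolean_morphism (ns t).
Proof.
have [tU tI tC t0 t1] := @subst_boolean _ A (extend t).
split=> [x y|x y|x||]; apply: val_inj.
- by rewrite !(val_neat_join, val_ns) tU.
- by rewrite !(val_neat_meet, val_ns) tI.
- by rewrite !(val_neat_compl, val_ns) tC.
- by rewrite val_ns val_neat_bot t0.
- by rewrite val_ns val_neat_top t1.
Qed.

Lemma neat_subst_id x : ns id x = x.
Proof. by apply: val_inj; rewrite !val_ns extend_id subst_id. Qed.

Lemma neat_subst_comp s t x : ns (s \o t) x = ns s (ns t x).
Proof. by apply: val_inj; rewrite !val_ns extend_comp subst_comp. Qed.

Lemma neat_subst_cyl (s t : S -> S) (G : set S) x :
  (forall i, (~` G)%classic i -> s i = t i) -> ns s (nc G x) = ns t (nc G x).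
Proof. by move=> st; apply: val_inj; apply/subst_cyl/extend_eq_off. Qed.

Lemma neat_cyl_subst (t : S -> S) (G D : set S) x :
  t @^-1` G = D -> set_inj D t -> nc G (ns t x) = ns t (nc D x).
Proof.
move=> tG tD; apply: val_inj.
by apply: cyl_subst; [exact: extend_preimage|exact: extend_inj].
Qed.

HB.instance Definition _ := hasPolyadic.Build S neat_reduct
  neat_cyl_bot neat_cyl_le neat_cyl_meet neat_cyl_set0 neat_cyl_setU
  neat_subst_boolean neat_subst_id neat_subst_comp neat_subst_cyl
  neat_cyl_subst.

End NeatReduct.

Section NeatFunctor.
Variables (d : Order.disp_t) (beta : orderType d) (alpha : beta).

Section Restriction.
Variables (A B : polyadicType beta) (f : embedding A B).

Notation Nr C := (neat_reduct alpha C : polyadicType (segment alpha)).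

Lemma neat_embedding x : neat alpha x -> neat alpha (f x).
Proof. by move=> /eqP xk; apply/eqP; rewrite -embedding_cyl xk. Qed.

Definition restriction_fun (x : Nr A) : Nr B :=
  Sub (f (val x)) (neat_embedding (valP x)).

Lemma restriction_inj : injective restriction_fun.
Proof. by move=> x y /(congr1 val) /embedding_inj /val_inj. Qed.

Lemma val_restriction x : val (restriction_fun x) = f (val x).
Proof. by []. Qed.

Lemma restriction_boolean : boolean_morphism restriction_fun.
Proof.
have [fU fI fC f0 f1] := embedding_boolean f.
split=> [x y|x y|x||]; apply: val_inj.
- by rewrite !(val_neat_join, val_restriction) fU.
- by rewrite !(val_neat_meet, val_restriction) fI.
- by rewrite !(val_neat_compl, val_restriction) fC.
- by rewrite val_restriction !val_neat_bot f0.
- by rewrite val_restriction !val_neat_top f1.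
Qed.

Lemma restriction_cyl G x :
  restriction_fun (cyl G x) = cyl G (restriction_fun x).
Proof. by apply: val_inj; apply: embedding_cyl. Qed.

Lemma restriction_subst t x :
  restriction_fun (subst t x) = subst t (restriction_fun x).
Proof. by apply: val_inj; apply: embedding_subst. Qed.

Definition restriction : embedding (Nr A) (Nr B) :=
  Embedding restriction_inj restriction_boolean restriction_cyl
    restriction_subst.

End Restriction.

Definition neatly_generated (A : PA beta) : Prop :=
  generated [set x : A | neat alpha x] = [set: A].

Definition L : category := full_subcategory neatly_generated.

Definition Nr_obj (A : L) : PA (segment alpha) := neat_reduct alpha (sval A).

Definition Nr_map (A B : L) (f : hom A B) : hom (Nr_obj A) (Nr_obj B) :=
  restriction f.

Lemma Nr_map1 (A : L) : Nr_map (idm A) = idm (Nr_obj A).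
Proof. by apply: embedding_ext => x; apply: val_inj. Qed.

Lemma Nr_mapM (A B C : L) (g : hom B C) (f : hom A B) :
  Nr_map (compm g f) = compm (Nr_map g) (Nr_map f).
Proof. by apply: embedding_ext => x; apply: val_inj. Qed.

Definition Nr : functor L (PA (segment alpha)) := Functor Nr_map1 Nr_mapM.

End NeatFunctor.

(* Main.v *)
Require Import Defs.
From HB Require Import structures.
From mathcomp Require Import all_boot all_order.
From mathcomp Require Import boolp classical_sets functions cardinality wochoice.

Set Implicit Arguments.
Unset Strict Implicit.
Unset Printing Implicit Defensive.

Import Order.Theory.

Local Open Scope classical_set_scope.
Local Open Scope order_scope.

(** Write [J] for [alpha] and [I] for [beta].  In a [beta]-dimensional algebra
    [B] generated by its neat [J]-reduct, every element has the form [s_rho x]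
    with [x] in the reduct and [rho : J -> I].  Such an element is determined by
    the family of elements [s_t s_rho x], where [t] ranges over the maps
    [I -> J] followed by the inclusion; this family lies in the reduct and
    equals [t |-> s_(t \o rho) x], an expression which only involves the
    [J]-dimensional algebra.  So, for an arbitrary [J]-dimensional [A], the
    algebra [G A] is defined to be the set of functions [(I -> J) -> A] of the
    form [t |-> s_(t \o rho) x] ([span rho x] below).  Boolean operations are
    pointwise, substitution is precomposition in the argument [t], and an
    embedding acts by composition on the left, so most axioms, the functor laws
    and both naturality squares hold by computation.

    The one fact from set theory is that any two maps [rho, sigma : J -> I]
    factor through a common injection [theta : J -> I] ([infinite_captures]); it
    rests on [|J| + |J| = |J|].  Any two elements of [G A] can therefore be
    written over one injective [theta], where they are just two elements of [A];
    this gives closure under meets and joins.  It also makes cylindrification,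
    [c_G (span rho x) = span rho (c_(rho^-1 G) x)] for [rho] injective on
    [rho^-1 G], independent of the representation ([span_cyl]): passing from
    [rho] to [theta] is an instance of the axiom of [A] that exchanges
    cylindrifications and substitutions.

    The counit [Nr (G A) -> A] evaluates at a retraction of [I] onto [J]; it is
    bijective because an element of [G A] fixed by [c_(I \ J)] can be written
    over the inclusion [J -> I] ([neat_dil_val]).  The unit [B -> G (Nr B)] is
    the map [b |-> (t |-> s_t b)] found above.  Its properties follow from the
    normal form of the elements of [B] ([spread_ex]), which in turn depends on
    computing [c_G s_rho x] inside [B] ([spread_cyl]). *)

(** * Doubling an infinite set *)

(** A maximal disjoint family of countably infinite subsets leaves out only
    finitely many points, and these can be added to one of its members. *)
Lemma infinite_partition (T : Type) : infinite_set [set: T] ->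
  exists P : set (set T), [/\ forall X, P X -> (X #= [set: nat])%card,
    trivIset P id & forall x, exists2 X, P X & X x].
Proof.
move=> Tinf; pose seqs := [set X : set T | (X #= [set: nat])%card].
have [E [Eseqs Etriv Emax]] := ex_maximal_disjoint_subcollection id seqs.
pose rest := (~` \bigcup_(X in E) X)%classic.
have rest_fin : finite_set rest.
  apply: contrapT => /infiniteP nat_rest.
  have [X Xrest Xnat] : exists2 X, X `<=` rest & (X #= [set: nat])%card.
    have [Y Ynat Yrest] := card_subP _ _ nat_rest.
    by exists Y => //; rewrite card_eq_sym.
  have Xfree : ~ E X.
    move=> EX; have [|x Xx] := @infinite_setN0 _ X.
      by apply/infiniteP; move/card_eqPle: Xnat => [].
    by apply: (Xrest x Xx); exists X.
  apply: (Emax (E `|` [set X])%classic); first split.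
  - by move=> Y; left.
  - by move/(_ X (or_intror erefl)).
  - by move=> Y [/Eseqs //|->].
  move=> Y Z [EY|->] [EZ|->] // [x [/= Yx Zx]].
  - by apply: Etriv => //; exists x.
  - by case: (Xrest x Zx); exists Y.
  - by case: (Xrest x Yx); exists Z.
have [E0 EE0] : exists X, E X.
  apply: contrapT => noE; apply: Tinf; apply: sub_finite_set rest_fin.
  by move=> x _ [X EX]; case: noE; exists X.
have E0nat : (E0 #= [set: nat])%card := Eseqs _ EE0.
exists (E `\` [set E0] `|` [set E0 `|` rest])%classic; split.
- move=> X [[/Eseqs//]|->]; apply: eq_card_nat.
    have cE0 : countable E0 by move/card_eqPle: E0nat => [].
    have cr := finite_set_countable rest_fin.
    rewrite -bigcup2E; apply: bigcup_countable => // -[|[|i]] _ //=.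
  rewrite finite_setU => -[E0fin _].
  by apply: infinite_nat; rewrite -(eq_finite_set E0nat).
- have off Y x : E Y -> Y <> E0 -> Y x -> ~ (E0 `|` rest)%classic x.
    move=> EY YE0 Yx [E0x|]; last by apply; exists Y.
    by apply: YE0; apply: Etriv => //; exists x.
  move=> X Y [[EX XE0]|->] [[EY YE0]|->] // [x [/= Xx Yx]].
  + by apply: Etriv => //; exists x.
  + by case: (off X x).
  + by case: (off Y x).
move=> x.
have [[X [EX XE0 Xx]]|none] := pselect (exists X, [/\ E X, X <> E0 & X x]).
  by exists X => //; left.
exists (E0 `|` rest)%classic; first by right.
have [[X EX Xx]|] := pselect ((\bigcup_(X in E) X) x); last by right.
left; have [<- //|XE0] := pselect (X = E0).
by case: none; exists X.
Qed.

(** Inside each block of the partition, identified with the natural numbers, the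
    maps [n |-> 2 n] and [n |-> 2 n + 1] do the job. *)
Lemma disjoint_injections (T : Type) : infinite_set [set: T] ->
  exists f g : T -> T,
    [/\ injective f, injective g & forall x y, f x <> g y].
Proof.
move=> Tinf; have [P [Pnat Ptriv Pcover]] := infinite_partition Tinf.
have /boolp.choice[block blockP] x : exists X, P X /\ X x.
  by have [X PX Xx] := Pcover x; exists X.
have /boolp.choice[enum enumP] X : exists e : (T -> nat) * (nat -> T), P X ->
    [/\ forall n, X (e.2 n), cancel e.2 e.1 & {in X &, injective e.1}].
  have [PX|nPX] := pselect (P X); last first.
    have [x _] := infinite_setN0 Tinf.
    by exists (fun=> 0%N, fun=> x).
  have /card_set_bijP[nu [_ nu_inj nu_surj]] := Pnat X PX.
  have /boolp.choice[e eP] n : exists x, X x /\ nu x = n.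
    by have [x] := nu_surj n I; exists x.
  by exists (nu, e) => _; split=> //= n; have [] := eP n.
(* [put h] applies [h : nat -> nat] to the position of a point in its block. *)
pose idx x := (enum (block x)).1 x.
pose put (h : nat -> nat) x := (enum (block x)).2 (h (idx x)).
have put_inj h k x y : put h x = put k y ->
    block x = block y /\ h (idx x) = k (idx y).
  move=> hk; have [[Px xx] [Py yy]] := (blockP x, blockP y).
  have bxy : block x = block y.
    apply: Ptriv => //; exists (put h x); split.
      by have [+ _ _] := enumP _ Px; apply.
    by rewrite hk; have [+ _ _] := enumP _ Py; apply.
  split=> //; move/(congr1 (enum (block y)).1): hk.
  by rewrite /put bxy; have [_ K _] := enumP _ Py; rewrite !K.
have idx_inj x y : block x = block y -> idx x = idx y -> x = y.
  move=> bxy; rewrite /idx -bxy; have [Px xx] := blockP x.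
  have [_ _] := enumP _ Px; apply; apply/mem_set => //.
  by rewrite bxy; have [] := blockP y.
exists (put double), (put (fun n => n.*2.+1)); split.
- by move=> x y /put_inj[bxy /double_inj ixy]; exact: idx_inj.
- by move=> x y /put_inj[bxy [/double_inj ixy]]; exact: idx_inj.
by move=> x y /put_inj[_ /(congr1 odd)]; rewrite /= !odd_double.
Qed.

(** Any two maps factor through a common split monomorphism [theta]; its left
    inverse [t] gives the factors as [t \o rho] and [t \o sigma].  A map [J -> I]
    must exist for the dilation to contain constants. *)
Definition captures (J I : Type) : Prop :=
  inhabited (J -> I) /\
  forall rho sigma : J -> I, exists (theta : J -> I) (t : I -> J),
    [/\ t \o theta = id, theta \o t \o rho = rho & theta \o t \o sigma = sigma].

(** The maps [rho], [sigma] and [inc] can be merged into one map [e] on [J], by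
    two uses of disjoint copies of [J] in [J].  Its range has at most as many
    elements as [J], and at least as many because of [inc]; a bijection from [J]
    onto it is the required [theta]. *)
Lemma infinite_captures (J I : Type) (inc : J -> I) :
  infinite_set [set: J] -> injective inc -> captures J I.
Proof.
move=> Jinf inc_inj; split=> [|rho sigma]; first exact: inhabits inc.
have [f [g [f_inj g_inj fg]]] := disjoint_injections Jinf.
have merge (a b : J -> I) : exists c, c \o f = a /\ c \o g = b.
  have /boolp.choice[c cP] x : exists i,
      (forall y, x = f y -> i = a y) /\ (forall y, x = g y -> i = b y).
    have [[y ->]|nf] := pselect (exists y, x = f y).
      by exists (a y); split=> [z /f_inj->//|z /fg].
    have [[y ->]|ng] := pselect (exists y, x = g y).
      by exists (b y); split=> [z /esym/fg|z /g_inj->//].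
    by exists (inc x); split=> y xy; [case: nf|case: ng]; exists y.
  exists c; split; apply/funext => y /=; first exact: (cP (f y)).1.
  exact: (cP (g y)).2.
have [c [cf cg]] := merge rho sigma.
have [e [ef eg]] := merge c inc.
have /card_bijP[h [k hK kK]] : ([set: J] #= range e)%card.
  apply: Cantor_Bernstein; last exact: (card_image_le e [set: J]).
  apply: (@card_le_trans _ _ _ (range inc)).
    have /inj_card_eq/card_eqPle[//] : {in [set: J] &, injective inc}.
    by move=> x y _ _; exact: inc_inj.
  by apply: subset_card_le => _ [y _ <-]; exists (g y) => //; rewrite -eg.
have [j0 _] := infinite_setN0 Jinf.
pose theta j := set_val (h (SigSub (mem_setT j))).
pose t i := if pselect (range e i) is left ei
  then set_val (k (SigSub (mem_set ei))) else j0.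
have rK i : range e i -> theta (t i) = i.
  rewrite /t /theta; case: pselect => // ei _.
  have -> : SigSub (mem_setT (set_val (k (SigSub (mem_set ei))))) =
      k (SigSub (mem_set ei)) by exact: val_inj.
  by rewrite kK.
have theta_e j : range e (theta j) by apply/set_mem; exact: (valP (h _)).
exists theta, t; split; apply/funext => j /=.
- rewrite /t; case: pselect => [ej|]; last by move/(_ (theta_e j)).
  have -> : SigSub (mem_set ej) = h (SigSub (mem_setT j)) by exact: val_inj.
  by rewrite hK.
- by apply: rK; exists (f (f j)); rewrite // -cf -ef.
by apply: rK; exists (f (g j)); rewrite // -cg -ef.
Qed.

(** * The dilation of a polyadic algebra *)

Lemma preimage_inj_comp (X Y Z : Type) (g : Y -> Z) (f : X -> Y) (G : set Z) :
  set_inj ((g \o f) @^-1` G) (g \o f) -> set_inj ((g \o f) @^-1` G) f.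
Proof. by move=> gf x y xG yG fxy; apply: gf => //=; rewrite fxy. Qed.

Section Span.
Variables (J I : Type) (A : polyadicType J).
Implicit Types (rho sigma theta : J -> I) (x y : A).

(** The element [s_rho x] of a dilation, coded by all its images under maps
    [I -> J]. *)
Definition span rho x : (I -> J) -> A := fun t => subst (t \o rho) x.

Lemma span_factor theta (i : J -> J) x :
  span (theta \o i) x = span theta (subst i x).
Proof. by apply/funext => t; rewrite /span -subst_comp. Qed.

Lemma span_refine theta t rho x :
  theta \o t \o rho = rho -> span rho x = span theta (subst (t \o rho) x).
Proof. by move=> rhoE; rewrite -span_factor; congr span. Qed.

Lemma span_retract theta t x : t \o theta = id -> span theta x t = x.
Proof. by rewrite /span => ->; exact: subst_id. Qed.

Lemma span_cyl_off rho sigma (D : set J) x :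
  (forall j, (~` D)%classic j -> rho j = sigma j) ->
  span rho (cyl D x) = span sigma (cyl D x).
Proof. by move=> rs; apply/funext => t; apply: subst_cyl => j /rs /= ->. Qed.

(** Since [theta] after [t \o rho] is [rho], the map [t \o rho] is injective on
    [rho^-1 G], and this set is its preimage of [theta^-1 G]; so [c] and [s] may
    be exchanged in [A]. *)
Lemma span_cyl_refine theta t rho (G : set I) x :
  theta \o t \o rho = rho -> set_inj (rho @^-1` G) rho ->
  span rho (cyl (rho @^-1` G) x) =
  span theta (cyl (theta @^-1` G) (subst (t \o rho) x)).
Proof.
move=> rhoE rho_inj; rewrite (span_refine _ rhoE); congr span.
apply/esym/cyl_subst; first by rewrite -[in RHS]rhoE.
by rewrite -[in X in set_inj X]rhoE; apply: (@preimage_inj_comp _ _ _ theta);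
  rewrite [theta \o _]rhoE.
Qed.

(** Both sides can be moved to a common [theta]; there the coefficient is a
    value of the function that [rho, x] and [sigma, y] both represent. *)
Lemma span_cyl (JI : captures J I) rho sigma (G : set I) x y :
  set_inj (rho @^-1` G) rho -> set_inj (sigma @^-1` G) sigma ->
  span rho x = span sigma y ->
  span rho (cyl (rho @^-1` G) x) = span sigma (cyl (sigma @^-1` G) y).
Proof.
move=> rho_inj sigma_inj xy; have [theta [t [tK rhoE sigmaE]]] := JI.2 rho sigma.
rewrite (span_cyl_refine _ rhoE) // (span_cyl_refine _ sigmaE) //.
by rewrite -[subst _ x]/(span rho x t) xy.
Qed.

End Span.

(** [JI] is a parameter of the type so that the algebraic structure, whose
    operations depend on it, can be inferred from the type alone. *)
Record dilation (J I : Type) (JI : captures J I) (A : polyadicType J) :=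
  Dilation {
    coord :> (I -> J) -> A;
    coord_span : exists (rho : J -> I) (x : A), coord = span rho x
  }.

Section Dilation.
Variables (J I : Type) (JI : captures J I) (A : polyadicType J).
Notation B := (dilation JI A).
Implicit Types (b c : B) (rho sigma theta : J -> I) (x y : A) (G : set I).

Lemma coord_inj : injective (@coord J I JI A).
Proof.
move=> [b bP] [c cP] /= bc; move: bP cP; rewrite bc => bP cP.
by congr Dilation; exact: Prop_irrelevance.
Qed.

Definition dil rho x : B := Dilation JI (ex_intro _ rho (ex_intro _ x erefl)).

(** Two elements of a dilation lie in a common copy of [A], the one spanned by
    an injective [theta]; this reduces identities in the dilation to [A]. *)
Lemma dil_pair b c : exists theta t x y,
  [/\ t \o theta = id, b = dil theta x & c = dil theta y].
Proof.
have [[rho [x bE]] [sigma [y cE]]] := (coord_span b, coord_span c).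
have [theta [t [tK rhoE sigmaE]]] := JI.2 rho sigma.
exists theta, t, (subst (t \o rho) x), (subst (t \o sigma) y).
split=> //; apply: coord_inj.
  by rewrite bE (span_refine _ rhoE).
by rewrite cE (span_refine _ sigmaE).
Qed.

Lemma dil_split b : exists theta t x, t \o theta = id /\ b = dil theta x.
Proof.
by have [theta [t [x [_ [tK bE _]]]]] := dil_pair b b; exists theta, t, x.
Qed.

Let subst_hom (t : J -> J) := @subst_boolean J A t.

Fact dil_meet_span b c : exists rho x, (fun t => b t `&` c t) = span rho x.
Proof.
have [theta [_ [x [y [_ -> ->]]]]] := dil_pair b c.
exists theta, (x `&` y); apply/funext => t.
by have [_ tI _ _ _] := subst_hom (t \o theta); rewrite /= /span tI.
Qed.

Fact dil_join_span b c : exists rho x, (fun t => b t `|` c t) = span rho x.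
Proof.
have [theta [_ [x [y [_ -> ->]]]]] := dil_pair b c.
exists theta, (x `|` y); apply/funext => t.
by have [tU _ _ _ _] := subst_hom (t \o theta); rewrite /= /span tU.
Qed.

Fact dil_compl_span b : exists rho x, (fun t => ~` b t) = span rho x.
Proof.
have [rho [x ->]] := coord_span b; exists rho, (~` x); apply/funext => t.
by have [_ _ tC _ _] := subst_hom (t \o rho); rewrite /= /span tC.
Qed.

Fact dil_const_span x : (forall t, subst t x = x) ->
  exists rho y, (fun=> x) = span rho y :> ((I -> J) -> A).
Proof.
move=> xfix; have [[rho] _] := JI.
by exists rho, x; apply/funext => t; rewrite /span xfix.
Qed.

Fact subst_bot t : subst t \bot = \bot :> A.
Proof. by have [] := subst_hom t. Qed.

Fact subst_top t : subst t \top = \top :> A.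
Proof. by have [] := subst_hom t. Qed.

Definition dil_meet b c : B := Dilation JI (dil_meet_span b c).
Definition dil_join b c : B := Dilation JI (dil_join_span b c).
Definition dil_compl b : B := Dilation JI (dil_compl_span b).
Definition dil_bot : B := Dilation JI (dil_const_span subst_bot).
Definition dil_top : B := Dilation JI (dil_const_span subst_top).

HB.instance Definition _ := gen_eqMixin B.
HB.instance Definition _ := gen_choiceMixin B.

Let ext b c : b =1 c -> b = c.
Proof. by move=> bc; apply/coord_inj/funext. Qed.

Fact dil_meetC : commutative dil_meet.
Proof. by move=> b c; apply: ext => t; apply: meetC. Qed.

Fact dil_joinC : commutative dil_join.
Proof. by move=> b c; apply: ext => t; apply: joinC. Qed.

Fact dil_meetA : associative dil_meet.
Proof. by move=> b c e; apply: ext => t; apply: meetA. Qed.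

Fact dil_joinA : associative dil_join.
Proof. by move=> b c e; apply: ext => t; apply: joinA. Qed.

Fact dil_joinKI c b : dil_meet b (dil_join b c) = b.
Proof. by apply: ext => t; apply: joinKI. Qed.

Fact dil_meetKU c b : dil_join b (dil_meet b c) = b.
Proof. by apply: ext => t; apply: meetKU. Qed.

Fact dil_meetUl : left_distributive dil_meet dil_join.
Proof. by move=> b c e; apply: ext => t; apply: meetUl. Qed.

Fact dil_meetxx : idempotent_op dil_meet.
Proof. by move=> b; apply: ext => t; apply: meetxx. Qed.

HB.instance Definition _ := @Order.isMeetJoinDistrLattice.Build
  polyadic_display B (fun b c => dil_meet b c == b)
  (fun b c => (c != b) && (dil_meet b c == b)) dil_meet dil_join
  (fun _ _ => erefl) (fun _ _ => erefl) dil_meetC dil_joinC dil_meetA dil_joinA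
  dil_joinKI dil_meetKU dil_meetUl dil_meetxx.

Fact dil_le0x b : dil_bot <= b.
Proof. by apply/eqP/ext => t; apply: meet0x. Qed.

Fact dil_lex1 b : b <= dil_top.
Proof. by apply/eqP/ext => t; apply: meetx1. Qed.

HB.instance Definition _ := Order.hasBottom.Build polyadic_display B dil_le0x.
HB.instance Definition _ := Order.hasTop.Build polyadic_display B dil_lex1.

Fact dil_joinxC b : b `|` dil_compl b = \top.
Proof. by apply: ext => t; apply: joinxC. Qed.

Fact dil_meetxC b : b `&` dil_compl b = \bot.
Proof. by apply: ext => t; apply: meetxC. Qed.

HB.instance Definition _ := Order.TBDistrLattice_hasComplement.Build
  polyadic_display B dil_joinxC dil_meetxC.

Fact dil_subst_span (s : I -> I) b :
  exists rho x, (fun t => b (t \o s)) = span rho x.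
Proof. by have [rho [x ->]] := coord_span b; exists (s \o rho), x. Qed.

Definition dil_subst s b : B := Dilation JI (dil_subst_span s b).

Lemma dil_subst_dil s rho x : dil_subst s (dil rho x) = dil (s \o rho) x.
Proof. exact: ext. Qed.

Lemma retract_set_inj (theta : J -> I) (t : I -> J) (D : set J) :
  t \o theta = id -> set_inj D theta.
Proof.
by move=> tK i j _ _ /(congr1 t); rewrite -![t (theta _)]/((t \o theta) _) tK.
Qed.

Lemma dil_cyl_subproof G b : exists c : B, forall rho x,
  set_inj (rho @^-1` G) rho -> b = dil rho x -> c = dil rho (cyl (rho @^-1` G) x).
Proof.
have [theta [t [x [tK bE]]]] := dil_split b.
exists (dil theta (cyl (theta @^-1` G) x)) => rho y rho_inj.
rewrite bE => /(congr1 (@coord _ _ _ _)) xy; apply: coord_inj.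
by apply: span_cyl => //; exact: retract_set_inj tK.
Qed.

(** Chosen rather than computed pointwise: [c_G b] at [t] need not be the
    supremum of the values of [b] at the maps that differ from [t] on [G]. *)
Definition dil_cyl G b : B := sval (cid (dil_cyl_subproof G b)).

Lemma dil_cyl_dil G rho x : set_inj (rho @^-1` G) rho ->
  dil_cyl G (dil rho x) = dil rho (cyl (rho @^-1` G) x).
Proof. by rewrite /dil_cyl; case: cid => c /= cP rho_inj; exact: cP. Qed.

Lemma dil_cyl_retract G theta t x : t \o theta = id ->
  dil_cyl G (dil theta x) = dil theta (cyl (theta @^-1` G) x).
Proof. by move=> tK; apply/dil_cyl_dil/retract_set_inj/tK. Qed.

Lemma dil_meetE rho x y : dil rho x `&` dil rho y = dil rho (x `&` y).
Proof.
by apply: ext => t /=; have [_ tI _ _ _] := subst_hom (t \o rho); rewrite /span tI.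
Qed.

Lemma dil_botE rho : dil rho \bot = \bot.
Proof. by apply: ext => t; apply: subst_bot. Qed.

Fact dil_cyl_bot G : dil_cyl G \bot = \bot.
Proof.
have [theta [t [_ [tK _]]]] := dil_split (\bot : B).
by rewrite -(dil_botE theta) (dil_cyl_retract _ _ tK) cyl_bot.
Qed.

Fact dil_cyl_le G b : b <= dil_cyl G b.
Proof.
have [theta [t [x [tK ->]]]] := dil_split b.
apply/meet_idPl; rewrite (dil_cyl_retract _ _ tK) dil_meetE.
by rewrite (meet_idPl (cyl_le _ _)).
Qed.

Fact dil_cyl_meet G b c :
  dil_cyl G (b `&` dil_cyl G c) = dil_cyl G b `&` dil_cyl G c.
Proof.
have [theta [t [x [y [tK -> ->]]]]] := dil_pair b c.
by rewrite !(dil_cyl_retract _ _ tK, dil_meetE) cyl_meet.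
Qed.

Fact dil_cyl_set0 b : dil_cyl set0 b = b.
Proof.
have [theta [t [x [tK ->]]]] := dil_split b.
by rewrite (dil_cyl_retract _ _ tK) preimage_set0 cyl_set0.
Qed.

Fact dil_cyl_setU G D b : dil_cyl G (dil_cyl D b) = dil_cyl (G `|` D)%classic b.
Proof.
have [theta [t [x [tK ->]]]] := dil_split b.
by rewrite !(dil_cyl_retract _ _ tK) cyl_setU preimage_setU.
Qed.

Fact dil_subst_boolean s : boolean_morphism (dil_subst s).
Proof. by split=> [b c|b c|b||]; apply: ext. Qed.

Fact dil_subst_id b : dil_subst id b = b.
Proof. exact: ext. Qed.

Fact dil_subst_comp s t b : dil_subst (s \o t) b = dil_subst s (dil_subst t b).
Proof. exact: ext. Qed.

Fact dil_subst_cyl (s t : I -> I) G b :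
  (forall i, (~` G)%classic i -> s i = t i) ->
  dil_subst s (dil_cyl G b) = dil_subst t (dil_cyl G b).
Proof.
move=> st; have [theta [r [x [rK ->]]]] := dil_split b.
rewrite (dil_cyl_retract _ _ rK) !dil_subst_dil; apply: coord_inj.
by apply: span_cyl_off => j /st.
Qed.

Fact dil_cyl_subst (s : I -> I) G D b :
  s @^-1` G = D -> set_inj D s ->
  dil_cyl G (dil_subst s b) = dil_subst s (dil_cyl D b).
Proof.
move=> <- s_inj; have [theta [t [x [tK ->]]]] := dil_split b.
rewrite (dil_cyl_retract _ _ tK) !dil_subst_dil dil_cyl_dil //.
(* [s] is injective on [D] and [theta] everywhere, hence [s \o theta] is
   injective on [theta^-1 D]. *)
move=> i j /set_mem iG /set_mem jG /s_inj thetaij.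
apply: (retract_set_inj (D := setT) tK); rewrite ?in_setT //.
by apply: thetaij; exact: mem_set.
Qed.

HB.instance Definition _ := hasPolyadic.Build I B
  dil_cyl_bot dil_cyl_le dil_cyl_meet dil_cyl_set0 dil_cyl_setU
  dil_subst_boolean dil_subst_id dil_subst_comp dil_subst_cyl
  dil_cyl_subst.

Lemma subst_dil (s : I -> I) rho x : subst s (dil rho x : B) = dil (s \o rho) x.
Proof. exact: dil_subst_dil. Qed.

Lemma cyl_dil G theta t x : t \o theta = id ->
  cyl G (dil theta x : B) = dil theta (cyl (theta @^-1` G) x).
Proof. exact: dil_cyl_retract. Qed.

End Dilation.

Arguments cyl_dil {J I JI A} G {theta t} x.

(** * Dilation as a functor *)

Lemma surjective_isomorphism (I : Type) (A B : polyadicType I) (f : embedding A B) :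
  (forall b, exists a, f a = b) -> @isomorphism (PA I) A B f.
Proof.
move=> /boolp.choice[g fK].
have g_inj : injective g by move=> b c /(congr1 f); rewrite !fK.
have [fU fI fC f0 f1] := embedding_boolean f; have f_inj := @embedding_inj _ _ _ f.
have g_boolean : boolean_morphism g.
  by split=> [b c|b c|b||]; apply: f_inj; rewrite ?(fU, fI, fC, f0, f1) !fK.
have g_cyl (G : set I) b : g (cyl G b) = cyl G (g b).
  by apply: f_inj; rewrite embedding_cyl !fK.
have g_subst (t : I -> I) b : g (subst t b) = subst t (g b).
  by apply: f_inj; rewrite embedding_subst !fK.
exists (Embedding g_inj g_boolean g_cyl g_subst).
by split; apply: embedding_ext => x //=; apply: f_inj; rewrite fK.
Qed.

Section DilationMap.
Variables (J I : Type) (JI : captures J I).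

Section Map.
Variables (A B : polyadicType J) (f : embedding A B).

Fact map_span (b : dilation JI A) : exists rho x, f \o b = span rho x.
Proof.
have [rho [x ->]] := coord_span b; exists rho, (f x).
by apply/funext => t; apply: embedding_subst.
Qed.

Definition dilation_fun (b : dilation JI A) : dilation JI B :=
  Dilation JI (map_span b).

Lemma dilation_fun_dil (rho : J -> I) x :
  dilation_fun (dil JI rho x) = dil JI rho (f x).
Proof. by apply/coord_inj/funext => t; apply: embedding_subst. Qed.

Lemma dilation_fun_inj : injective dilation_fun.
Proof.
move=> b c /(congr1 (@coord _ _ _ _)) bc; apply/coord_inj/funext => t.
exact/(@embedding_inj _ _ _ f)/(congr1 (@^~ t) bc).
Qed.

Lemma dilation_fun_boolean : boolean_morphism dilation_fun.
Proof.
have [fU fI fC f0 f1] := embedding_boolean f.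
split=> [b c|b c|b||]; apply/coord_inj/funext => t.
- exact: fU.
- exact: fI.
- exact: fC.
- exact: f0.
- exact: f1.
Qed.

Lemma dilation_fun_cyl (G : set I) b :
  dilation_fun (cyl G b) = cyl G (dilation_fun b).
Proof.
have [theta [t [x [tK ->]]]] := dil_split b.
by rewrite dilation_fun_dil !(cyl_dil _ _ tK) dilation_fun_dil embedding_cyl.
Qed.

Lemma dilation_fun_subst (s : I -> I) b :
  dilation_fun (subst s b) = subst s (dilation_fun b).
Proof. exact/coord_inj/funext. Qed.

Definition dilation_map : embedding (dilation JI A) (dilation JI B) :=
  Embedding dilation_fun_inj dilation_fun_boolean dilation_fun_cyl
    dilation_fun_subst.

End Map.

Lemma dilation_map1 (A : polyadicType J) :
  dilation_map (idemb A) = idemb (dilation JI A).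
Proof. by apply: embedding_ext => b; apply/coord_inj/funext. Qed.

Lemma dilation_mapM (A B C : polyadicType J) (g : embedding B C)
    (f : embedding A B) :
  dilation_map (compemb g f) = compemb (dilation_map g) (dilation_map f).
Proof. by apply: embedding_ext => b; apply/coord_inj/funext. Qed.

End DilationMap.

Section Segment.
Variables (d : Order.disp_t) (beta : orderType d) (alpha : beta).
Variable JI : captures (segment alpha) beta.
Notation J := (segment alpha).

(** Any value serves outside the segment; [captures] provides one. *)
Lemma segment_retraction : exists r : beta -> J, r \o val = id.
Proof.
have [[rho] /(_ rho rho)[_ [t _]]] := JI.
by exists (fun i => odflt (t alpha) (insub i)); apply/funext => j /=; rewrite valK.
Qed.

Definition retr : beta -> J := sval (cid segment_retraction).

Lemma retr_val : retr \o val = id.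
Proof. by rewrite /retr; case: cid. Qed.

Lemma retrK : cancel val retr.
Proof. by move=> j; exact: (congr1 (@^~ j) retr_val). Qed.

Lemma outside_preimage_val : val @^-1` (outside alpha) = set0 :> set J.
Proof. by apply/seteqP; split=> j // /outside_val. Qed.

Lemma preimage_image_val (G : set J) : val @^-1` (val @` G) = G.
Proof. by apply/seteqP; split=> j /= /image_valP. Qed.

(** ** The neat reduct of a dilation *)

Section Counit.
Variable A : polyadicType J.
Notation B := (dilation JI A).

Lemma dil_val_neat (x : A) : neat alpha (dil JI val x).
Proof.
by apply/eqP; rewrite (cyl_dil _ _ retr_val) outside_preimage_val cyl_set0.
Qed.

(** The preimage [D] of [I \ J] consists of the coordinates that [theta] moves
    out of [J].  As [x] is fixed by [c_D], [theta] may be changed on [D], and so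
    replaced by a map into [J]. *)
Lemma neat_dil_val (b : B) : neat alpha b -> exists x, b = dil JI val x.
Proof.
move=> /eqP; have [theta [t [x [tK ->]]]] := dil_split b.
set D := theta @^-1` outside alpha.
rewrite (cyl_dil _ _ tK) -/D => <-.
exists (subst (retr \o theta) (cyl D x)); apply: coord_inj => /=.
rewrite -span_factor; apply: span_cyl_off => j /= Dj.
have [[k thetaj]|//] := segmentP alpha (theta j).
by rewrite thetaj retrK.
Qed.

Lemma dilation_neatly_generated : @neatly_generated _ beta alpha B.
Proof.
apply/seteqP; split=> // b _ S [Ssub neatS].
have [rho [x bE]] := coord_span b.
have -> : b = subst (rho \o retr) (dil JI val x).
  apply: coord_inj; rewrite bE; congr span.
  by apply/funext => j /=; rewrite retrK.
by case: Ssub => _ _ _ _; apply; apply/neatS/dil_val_neat.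
Qed.

(** Evaluation at any retraction would give the same map, since the elements of
    the neat reduct are those represented over the inclusion of [J]. *)
Definition counit_fun (b : neat_reduct alpha B) : A := val b retr.

Lemma counit_dil b x : val b = dil JI val x -> counit_fun b = x.
Proof. by rewrite /counit_fun => ->; exact: span_retract retr_val. Qed.

Lemma counit_inj : injective counit_fun.
Proof.
move=> b c; have [[x bE] [y cE]] := (neat_dil_val (valP b), neat_dil_val (valP c)).
by rewrite (counit_dil bE) (counit_dil cE) => xy; apply: val_inj; rewrite bE cE xy.
Qed.

Lemma counit_boolean : boolean_morphism counit_fun.
Proof.
split=> [b c|b c|b||]; rewrite /counit_fun.
- by rewrite val_neat_join.
- by rewrite val_neat_meet.
- by rewrite val_neat_compl.
- by rewrite val_neat_bot.
- by rewrite val_neat_top.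
Qed.

Lemma counit_cyl (G : set J) b : counit_fun (cyl G b) = cyl G (counit_fun b).
Proof.
have [x bE] := neat_dil_val (valP b); rewrite (counit_dil bE); apply: counit_dil.
have -> : val (cyl G b) = cyl (val @` G) (val b) by [].
by rewrite bE [LHS](cyl_dil _ _ retr_val) preimage_image_val.
Qed.

Lemma counit_subst (t : J -> J) b : counit_fun (subst t b) = subst t (counit_fun b).
Proof.
have [x bE] := neat_dil_val (valP b); rewrite (counit_dil bE); apply: counit_dil.
have -> : val (subst t b) = subst (extend t) (val b) by [].
rewrite bE [LHS]subst_dil; apply: coord_inj; rewrite /= -span_factor.
by congr span; apply/funext => j; apply: extend_val.
Qed.

Definition counit : embedding (neat_reduct alpha B) A :=
  Embedding counit_inj counit_boolean counit_cyl counit_subst.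

Lemma counit_surj x : exists b, counit b = x.
Proof. by exists (Sub (dil JI val x) (dil_val_neat x)); apply: counit_dil. Qed.

End Counit.

(** ** An algebra generated by its neat reduct *)

Section Unit.
Variable B : polyadicType beta.
Hypothesis Bgen : @neatly_generated _ beta alpha B.
Notation Nr := (neat_reduct alpha B).
Implicit Types (G : set beta) (rho sigma theta : J -> beta) (x y : Nr).

(** Neat elements do not depend on the coordinates outside [alpha]. *)
Lemma neat_subst_eq (s t : beta -> beta) (x : Nr) :
  s \o val = t \o (val : J -> beta) -> subst s (val x) = subst t (val x).
Proof.
move=> st; have /eqP <- := valP x; apply: subst_cyl => i ni.
by have [[j ->]|//] := segmentP alpha i; exact: (congr1 (@^~ j) st).
Qed.

(** The analogue of [span] inside an algebra of dimension [beta]; extending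
    [rho] along the retraction is as good as any other extension, by
    [neat_subst_eq]. *)
Definition spread (rho : J -> beta) (x : Nr) : B := subst (rho \o retr) (val x).

Lemma spread_val (x : Nr) : spread val x = val x.
Proof.
by rewrite -[RHS]subst_id; apply: neat_subst_eq; apply/funext => j /=; rewrite retrK.
Qed.

Lemma subst_spread s rho x : subst s (spread rho x) = spread (s \o rho) x.
Proof. by rewrite /spread -subst_comp. Qed.

Lemma spread_factor theta (i : J -> J) x :
  spread (theta \o i) x = spread theta (subst i x).
Proof.
rewrite /spread -subst_comp.
apply: neat_subst_eq; apply/funext => j /=.
by rewrite extend_val !retrK.
Qed.

(** To exchange [c_G] with the substitution, the latter has to be injective on
    the preimage of [G].  Extending [rho] by a constant [p] outside [G] keeps
    the preimage of [G] within [alpha], where [rho] is injective. *)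
Lemma spread_cyl_proper G rho t x : t \o rho = id -> (exists p, ~ G p) ->
  cyl G (spread rho x) = spread rho (cyl (rho @^-1` G) x).
Proof.
move=> tK [p nGp].
pose s i := if insub i is Some j then rho j else p.
have s_val j : s (val j) = rho j by rewrite /s valK.
have s_out i : outside alpha i -> s i = p by move=> o; rewrite /s insubN.
have spreadE y : spread rho y = subst s (val y).
  apply: neat_subst_eq; apply/funext => j /=; by rewrite s_val retrK.
have sG i : G (s i) -> exists2 j, i = val j & G (rho j).
  have [[j ->]|/s_out->//] := segmentP alpha i.
  by rewrite s_val; exists j.
rewrite !spreadE; apply: cyl_subst.
  apply/seteqP; split=> [i /sG[j -> Gj]|_ [j Gj <-]]; first by exists j.
  by rewrite /preimage /= s_val.
move=> _ _ /set_mem[i Gi <-] /set_mem[j Gj <-]; rewrite !s_val => /(congr1 t).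
by rewrite -![t (rho _)]/((t \o rho) _) tK => /= ->.
Qed.

(** The full set of coordinates leaves no value for the extension, but it is the
    union of two proper subsets, which can be quantified one after the other. *)
Lemma spread_cyl G rho t x : t \o rho = id ->
  cyl G (spread rho x) = spread rho (cyl (rho @^-1` G) x).
Proof.
move=> tK; have [|full] := pselect (exists p, ~ G p).
  exact: spread_cyl_proper tK.
pose j0 := t alpha.
have -> : G = (~` [set val j0] `|` [set val j0])%classic.
  rewrite setUC setUv; apply/seteqP; split=> // p _.
  by apply: contrapT => nGp; apply: full; exists p.
rewrite -cyl_setU (spread_cyl_proper _ tK); last first.
  by exists alpha => /= aj; have : sval j0 < alpha := valP j0; rewrite -aj ltxx.
rewrite (spread_cyl_proper _ tK); last by exists (val j0); apply.
by rewrite cyl_setU -preimage_setU.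
Qed.

Lemma spread_pair_of rho sigma x y : exists theta t x' y',
  [/\ t \o theta = id, spread rho x = spread theta x'
    & spread sigma y = spread theta y'].
Proof.
have [theta [t [tK rhoE sigmaE]]] := JI.2 rho sigma.
exists theta, t, (subst (t \o rho) x), (subst (t \o sigma) y).
by rewrite -!spread_factor [theta \o (_ \o rho)]rhoE [theta \o (_ \o sigma)]sigmaE.
Qed.

Lemma spread_meet rho x y : spread rho x `&` spread rho y = spread rho (x `&` y).
Proof.
have [_ sI _ _ _] := @subst_boolean _ B (rho \o retr).
by rewrite /spread val_neat_meet sI.
Qed.

Lemma spread_join rho x y : spread rho x `|` spread rho y = spread rho (x `|` y).
Proof.
have [sU _ _ _ _] := @subst_boolean _ B (rho \o retr).
by rewrite /spread val_neat_join sU.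
Qed.

(** The elements of this form are a subalgebra containing the neat elements, and
    neat elements generate. *)
Lemma spread_ex b : exists rho x, b = spread rho x.
Proof.
have bgen : generated [set x : B | neat alpha x] b by rewrite Bgen.
apply: (bgen [set c | exists rho x, c = spread rho x]); split; last first.
  by move=> x nx; exists val, (Sub x nx); rewrite spread_val.
split.
- split; [exists val, \bot|exists val, \top]; rewrite spread_val.
    by rewrite val_neat_bot.
  by rewrite val_neat_top.
- move=> _ [rho [x ->]]; exists rho, (~` x).
  have [_ _ sC _ _] := @subst_boolean _ B (rho \o retr).
  by rewrite /spread val_neat_compl sC.
- move=> _ _ [rho [x ->]] [sigma [y ->]].
  have [theta [t [x' [y' [_ -> ->]]]]] := spread_pair_of rho sigma x y.
  by rewrite spread_meet spread_join; split; do 2 eexists.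
- move=> G _ [rho [x ->]].
  have [theta [t [x' [_ [tK -> _]]]]] := spread_pair_of rho rho x x.
  by rewrite (spread_cyl _ _ tK); do 2 eexists.
- by move=> t _ [rho [x ->]]; rewrite subst_spread; do 2 eexists.
Qed.

Lemma spread_pair b c : exists theta t x y,
  [/\ t \o theta = id, b = spread theta x & c = spread theta y].
Proof.
have [[rho [x ->]] [sigma [y ->]]] := (spread_ex b, spread_ex c).
exact: spread_pair_of.
Qed.

(** No coordinate is sent outside [alpha], so the cylindrification by that
    outside passes through the substitution as one by the empty set. *)
Lemma neat_subst_val (t : beta -> J) (b : B) : neat alpha (subst (val \o t) b).
Proof.
apply/eqP; rewrite (@cyl_subst _ _ _ _ set0) ?cyl_set0 //.
  by rewrite comp_preimage outside_preimage_val preimage_set0.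
by move=> i j; rewrite in_set0.
Qed.

Definition unit_coord (b : B) (t : beta -> J) : Nr :=
  Sub (subst (val \o t) b) (neat_subst_val t b).

Lemma unit_coord_spread rho x : unit_coord (spread rho x) = span rho x.
Proof.
apply/funext => t; apply: val_inj => /=.
rewrite subst_spread /spread; apply: neat_subst_eq; apply/funext => j /=.
by rewrite extend_val retrK.
Qed.

Lemma unit_span b : exists rho x, unit_coord b = span rho x.
Proof.
by have [rho [x ->]] := spread_ex b; exists rho, x; exact: unit_coord_spread.
Qed.

Definition unit_fun b : dilation JI Nr := Dilation JI (unit_span b).

Lemma unit_spread rho x : unit_fun (spread rho x) = dil JI rho x.
Proof. exact/coord_inj/unit_coord_spread. Qed.

Lemma unit_inj : injective unit_fun.
Proof.
move=> b c; have [theta [t [x [y [tK -> ->]]]]] := spread_pair b c.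
rewrite !unit_spread => /(congr1 (fun e : dilation JI Nr => e t)) /=.
by rewrite !(span_retract _ tK) => ->.
Qed.

Lemma unit_boolean : boolean_morphism unit_fun.
Proof.
split=> [b c|b c|b||]; apply/coord_inj/funext => t; apply: val_inj;
  have [sU sI sC s0 s1] := @subst_boolean _ B (val \o t).
- by rewrite [RHS]val_neat_join; exact: sU.
- by rewrite [RHS]val_neat_meet; exact: sI.
- exact: sC.
- by rewrite [RHS]val_neat_bot; exact: s0.
- by rewrite [RHS]val_neat_top; exact: s1.
Qed.

Lemma unit_cyl (G : set beta) b : unit_fun (cyl G b) = cyl G (unit_fun b).
Proof.
have [theta [t [x [_ [tK -> _]]]]] := spread_pair b b.
by rewrite (spread_cyl _ _ tK) !unit_spread [RHS](cyl_dil _ _ tK).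
Qed.

Lemma unit_subst (s : beta -> beta) b : unit_fun (subst s b) = subst s (unit_fun b).
Proof.
by apply/coord_inj/funext => t; apply: val_inj; rewrite /= -subst_comp.
Qed.

Definition unit_emb : embedding B (dilation JI Nr) :=
  Embedding unit_inj unit_boolean unit_cyl unit_subst.

Lemma unit_surj c : exists b, unit_emb b = c.
Proof.
have [theta [_ [x [_ ->]]]] := dil_split c.
by exists (spread theta x); exact: unit_spread.
Qed.

End Unit.

(** ** The natural isomorphisms *)

Definition dilation_obj (A : PA J) : L alpha :=
  exist (@neatly_generated _ beta alpha) (dilation JI A)
    (dilation_neatly_generated A).

Definition dilation_functor : functor (PA J) (L alpha) :=
  @Functor (PA J) (L alpha) dilation_obj (@dilation_map _ _ JI)
    (@dilation_map1 _ _ JI) (@dilation_mapM _ _ JI).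

Definition unit_iso :
  natural_iso (functor_id (L alpha)) (functor_comp dilation_functor (Nr alpha)).
Proof.
exists (fun B : L alpha => unit_emb (svalP B)) => [B C f|B].
  apply: embedding_ext => b; apply/coord_inj/funext => t; apply: val_inj => /=.
  by rewrite embedding_subst.
exact: surjective_isomorphism (unit_surj (svalP B)).
Defined.

Definition counit_iso :
  natural_iso (functor_comp (Nr alpha) dilation_functor) (functor_id (PA J)).
Proof.
exists (@counit) => [A B f|A]; first exact: embedding_ext.
exact: surjective_isomorphism (@counit_surj A).
Defined.

End Segment.

Theorem theorem43 (d : Order.disp_t) (beta : orderType d) (alpha : beta)
    (beta_ordinal : well_order (<=%O : rel beta))
    (alpha_infinite : infinite_set [set i : beta | i < alpha]) :
  exists G : functor (PA (segment alpha)) (L alpha),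
    inhabited (natural_iso (functor_id (L alpha)) (functor_comp G (Nr alpha))) /\
    inhabited (natural_iso (functor_comp (Nr alpha) G)
                           (functor_id (PA (segment alpha)))).
Proof.
have JI : captures (segment alpha) beta.
  apply: (@infinite_captures _ _ val); last exact: val_inj.
  move=> fin; apply: alpha_infinite.
  apply: sub_finite_set (finite_image val fin) => i ai.
  by exists (Sub i ai : segment alpha); rewrite ?SubK.
exists (dilation_functor JI); split.
  exact: inhabits (unit_iso JI).
exact: inhabits (counit_iso JI).
Qed.
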